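(* Let $\alpha:I\to\mathbb{R}^{3,1}$ and $\delta:J\to\mathbb{R}^{3,1}$ ($I,J\subset\mathbb{R}$ open intervals) be two smooth regular spacelike curves which are orthogonal, i.e. $\langle\alpha'(x),\delta'(y)\rangle=0$ for all $x\in I,y\in J$, and such that $\delta$ lies in the hyperplane orthogonal to $e_1=(1,0,0,0)$. Let $M$ be the spacelike (translation) surface parametrized by $\psi(x,y)=\alpha(x)+\delta(y)$. Then the canonical vector field $e_1$ induces a canonical normal null direction on $M$ if and only if $$\langle e_1^\top,\alpha'(x)\rangle^2=|\alpha'(x)|^2$$ at every point of $M$.
   Context: $\mathbb{R}^{3,1}$ is $\mathbb{R}^4$ with the metric $\langle\cdot,\cdot\rangle=dx_1^2+dx_2^2+dx_3^2-dx_4^2$. A regular curve is spacelike if $\langle\alpha',\alpha'\rangle>0$; $|\alpha'|^2=\langle\alpha',\alpha'\rangle$. A surface is spacelike if its induced metric is Riemannian. $e_1=e_1^\top+e_1^\perp$ is the decomposition of the constant vector field $e_1$ into its parts tangent and normal to $M$. $e_1$ induces a canonical normal null direction on $M$ (i.e. $M$ has a canonical normal null direction with respect to $e_1$) if $e_1^\perp$ is a lightlike normal vector field along $M$ (nonzero with $\langle e_1^\perp,e_1^\perp\rangle=0$).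
   Formalization: The formal statement adds that e_1 is nowhere tangent to M (e_1^⊥ never vanishes); without it the ''if'' direction fails, e.g. for α(x)=x e_1, δ(y)=y e_2, where the equation holds but e_1^⊥=0 is not lightlike. *)

(* Defs.v *)
From HB Require Import structures.
From mathcomp Require Import all_boot all_order all_algebra.
From mathcomp Require Import all_classical all_reals all_analysis.
From mathcomp Require Import ring lra.
Set Implicit Arguments.
Unset Strict Implicit.
Unset Printing Implicit Defensive.
Import Order.TTheory GRing.Theory Num.Theory.
Import numFieldNormedType.Exports.
Local Open Scope classical_set_scope.
Local Open Scope ring_scope.

(* The Minkowski space R^{3,1} is 'rV[R]_4; the coordinates are numbered from 0,
   so the index 3 is the time-like direction x_4. *)
Definition minkowski_metric (R : realType) (u v : 'rV[R]_4) : R :=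
  \sum_(i < 4) (if (i < 3)%N then 1 else -1) * (u 0 i * v 0 i).

Definition lightlike (R : realType) (v : 'rV[R]_4) : Prop :=
  v <> 0 /\ minkowski_metric v v = 0.

Definition e1 (R : realType) : 'rV[R]_4 := delta_mx 0 0.
Arguments e1 {R}.

Definition open_interval (R : realType) (I : set R) : Prop :=
  open I /\ is_interval I.

(* Curves are total functions; every notion below only involves their
   restriction to the open interval I. *)
Definition smooth_on (R : realType) (I : set R) (c : R -> 'rV[R]_4) : Prop :=
  forall (n : nat) (x : R), I x -> derivable (derive1n n c) x 1.

Definition regular_on (R : realType) (I : set R) (c : R -> 'rV[R]_4) : Prop :=
  forall x, I x -> derive1 c x <> 0.

Definition spacelike_curve (R : realType) (I : set R) (c : R -> 'rV[R]_4)
  : Prop :=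
  forall x, I x -> 0 < minkowski_metric (derive1 c x) (derive1 c x).

Section Surfaces.
Variable R : realType.
Implicit Types (psi : R -> R -> 'rV[R]_4) (x y : R) (v : 'rV[R]_4).

Definition translation_surface (alpha delta : R -> 'rV[R]_4)
  : R -> R -> 'rV[R]_4 := fun x y => alpha x + delta y.

Definition partial_x psi x y : 'rV[R]_4 := derive1 (fun s => psi s y) x.
Definition partial_y psi x y : 'rV[R]_4 := derive1 (fun t => psi x t) y.

Definition tangent_plane psi x y : set 'rV[R]_4 :=
  [set v | exists a b, v = a *: partial_x psi x y + b *: partial_y psi x y].

Definition normal_plane psi x y : set 'rV[R]_4 :=
  [set v | forall w, tangent_plane psi x y w -> minkowski_metric v w = 0].

(* The metric induced on the parameter domain I x J, i.e. the pull-back of the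
   Minkowski metric by the differential (a, b) |-> a psi_x + b psi_y, is
   positive definite; in particular psi is an immersion. *)
Definition spacelike_surface (I J : set R) psi : Prop :=
  forall x y, I x -> J y -> forall a b, (a, b) <> (0, 0) ->
  let w := a *: partial_x psi x y + b *: partial_y psi x y in
  0 < minkowski_metric w w.

(* The tangent vector whose difference with v is normal. It exists and is
   unique on a spacelike surface, see tangent_partP and tangent_part_unique;
   0 is only a default value. *)
Definition tangent_part psi x y v : 'rV[R]_4 :=
  xget 0 [set t | tangent_plane psi x y t /\ normal_plane psi x y (v - t)].

Definition normal_part psi x y v : 'rV[R]_4 := v - tangent_part psi x y v.

Definition canonical_normal_null_direction (I J : set R) psi v : Prop :=
  forall x y, I x -> J y -> lightlike (normal_part psi x y v).

(* On a spacelike surface: normal_part psi x y v is nonzero at every point.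
   The plane parametrized by x e_1 + y e_2 shows that e_1 may be tangent to a
   translation surface even if <e_1^T, alpha'>^2 = |alpha'|^2. *)
Definition nowhere_tangent (I J : set R) psi v : Prop :=
  forall x y, I x -> J y -> ~ tangent_plane psi x y v.

Lemma metricC u v : minkowski_metric u v = minkowski_metric v u.
Proof. by apply: eq_bigr => i _; rewrite (mulrC (u 0 i)). Qed.

Lemma metricDl u v w :
  minkowski_metric (u + v) w = minkowski_metric u w + minkowski_metric v w.
Proof.
by rewrite -big_split; apply: eq_bigr => i _; rewrite !mxE mulrDl mulrDr.
Qed.

Lemma metricZl a u v :
  minkowski_metric (a *: u) v = a * minkowski_metric u v.
Proof.
by rewrite mulr_sumr; apply: eq_bigr => i _; rewrite !mxE -mulrA mulrCA.
Qed.

Lemma metricDr u v w :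
  minkowski_metric w (u + v) = minkowski_metric w u + minkowski_metric w v.
Proof. by rewrite metricC metricDl !(metricC w). Qed.

Lemma metricZr a u v :
  minkowski_metric v (a *: u) = a * minkowski_metric v u.
Proof. by rewrite metricC metricZl (metricC v). Qed.

Lemma metricNl u v :
  minkowski_metric (- u) v = - minkowski_metric u v.
Proof. by rewrite -scaleN1r metricZl mulN1r. Qed.

Lemma tangent_partP (I J : set R) psi x y v :
  spacelike_surface I J psi -> I x -> J y ->
  tangent_plane psi x y (tangent_part psi x y v) /\
  normal_plane psi x y (normal_part psi x y v).
Proof.
move=> Spsi Ix Jy; rewrite /normal_part /tangent_part.
set P := [set t | _]; suff : exists t, P t by move=> /(xgetPex 0).
have := Spsi x y Ix Jy; rewrite /P /= /normal_plane /tangent_plane /=.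
move: (partial_x psi x y) (partial_y psi x y) => p q pos.
set E := minkowski_metric p p; set F := minkowski_metric p q.
set G := minkowski_metric q q.
have E0 : 0 < E.
  have := pos 1 0; rewrite scale1r scale0r addr0; apply.
  by case=> /eqP; rewrite oner_eq0.
have D0 : 0 < E * (E * G - F ^+ 2).
  have := pos (- F) E; rewrite !(metricDl, metricDr, metricZl, metricZr)
    (metricC q p) -/E -/F -/G => H.
  have /H : (- F, E) <> (0, 0) by case=> _ /eqP; rewrite gt_eqF.
  by move=> ?; lra.
have D1 : E * G - F ^+ 2 != 0.
  by move: D0; rewrite pmulr_rgt0// => /lt0r_neq0.
set c := minkowski_metric v p; set d := minkowski_metric v q.
exists (((c * G - d * F) / (E * G - F ^+ 2)) *: p
        + ((d * E - c * F) / (E * G - F ^+ 2)) *: q).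
split; first by do 2 eexists.
move=> _ [a [b ->]].
rewrite !(metricDl, metricDr, metricNl, metricZl, metricZr) (metricC q p).
rewrite -/E -/F -/G -/c -/d.
by field.
Qed.

Lemma tangent_part_unique (I J : set R) psi x y v t :
  spacelike_surface I J psi -> I x -> J y ->
  tangent_plane psi x y t -> normal_plane psi x y (v - t) ->
  tangent_part psi x y v = t.
Proof.
move=> Spsi Ix Jy Tt Nt; apply: xget_unique => // s [[a [b sE]] Ns].
case: Tt => a' [b' tE].
have dE : s - t = (a - a') *: partial_x psi x y + (b - b') *: partial_y psi x y.
  by rewrite sE tE !scalerBl opprD addrACA.
have Td : tangent_plane psi x y (s - t) by exists (a - a'), (b - b').
have d0 : minkowski_metric (s - t) (s - t) = 0.
  have -> : s - t = (v - t) - (v - s) by rewrite opprB [RHS]addrC subrKA.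
  rewrite metricDl metricNl.
  have -> : v - t - (v - s) = s - t by rewrite opprB addrC subrKA.
  by rewrite Nt// Ns// subr0.
apply/eqP; rewrite -subr_eq0; apply/eqP.
have [[a0 b0]|/eqP ab0] := eqVneq (a - a', b - b') (0, 0).
  by rewrite dE a0 b0 !scale0r addr0.
by have := Spsi x y Ix Jy _ _ ab0; rewrite /= -dE d0 ltxx.
Qed.

End Surfaces.

(* Main.v *)
Require Import Defs.
From HB Require Import structures.
From mathcomp Require Import all_boot all_order all_algebra.
From mathcomp Require Import all_classical all_reals all_analysis.
Import Order.TTheory GRing.Theory Num.Theory.
Import numFieldNormedType.Exports.
Local Open Scope classical_set_scope.
Local Open Scope ring_scope.

(** Put E = |alpha'(x)|^2 and c = <e_1, alpha'(x)>. The tangent plane of the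
    translation surface at (x, y) is spanned by alpha'(x) and delta'(y). These
    are orthogonal by hypothesis, and e_1 is orthogonal to delta'(y) because
    delta stays in the hyperplane orthogonal to e_1; hence the tangent part of
    e_1 is its projection onto alpha'(x) alone, e_1^T = (c / E) alpha'(x)
    ([tangent_part_orthogonal]). Consequently <e_1^T, alpha'(x)> = c and, by
    the Pythagorean identity ([metric_normal_part]),
    <e_1^perp, e_1^perp> = <e_1, e_1> - <e_1^T, e_1^T> = 1 - c^2 / E.
    So e_1^perp is null exactly when c^2 = E, and it is nonzero because e_1 is
    nowhere tangent to the surface. *)

Lemma derive1_add_cst (R : realType) (V : normedModType R) (f : R -> V) (v : V)
    (x : R) :
  derive1 (fun s => f s + v) x = derive1 f x.
Proof.
by rewrite /derive1; under eq_fun do rewrite opprD addrACA subrr addr0.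
Qed.

Lemma derive1_cst_add (R : realType) (V : normedModType R) (f : R -> V) (v : V)
    (x : R) :
  derive1 (fun s => v + f s) x = derive1 f x.
Proof. by under eq_fun do rewrite addrC; exact: derive1_add_cst. Qed.

(** Used to see that the velocity of a curve lying in the hyperplane orthogonal
    to e_1 is itself orthogonal to e_1. *)
Lemma derive1_coord_cst (R : realType) (m n : nat) (c : R -> 'M[R]_(m, n))
    (J : set R) (y k : R) (i : 'I_m) (j : 'I_n) :
  open J -> J y -> derivable c y 1 -> (forall t, J t -> c t i j = k) ->
  derive1 c y i j = 0.
Proof.
move=> oJ Jy cy ck; rewrite derive1E derive_mx// mxE.
rewrite (@near_eq_derive _ _ _ _ (cst k)) ?derive_cst//.
by apply: filterS (open_nbhs_nbhs (conj oJ Jy)) => t /ck.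
Qed.

Lemma metric_e1r (R : realType) (v : 'rV[R]_4) : minkowski_metric v e1 = v 0 0.
Proof.
by rewrite /minkowski_metric !big_ord_recl big_ord0 /= !mxE/=
  !(mulr0, addr0, mulr1, mul1r).
Qed.

Section NormalPart.
Variables (R : realType) (I J : set R) (psi : R -> R -> 'rV[R]_4) (x y : R).
Hypotheses (Spsi : spacelike_surface I J psi) (Ix : I x) (Jy : J y).
Variable v : 'rV[R]_4.

(** Pythagoras: the tangent and normal parts of v are orthogonal to each other,
    so the cross terms of <v, v> vanish. *)
Lemma metric_normal_part :
  minkowski_metric (normal_part psi x y v) (normal_part psi x y v) =
  minkowski_metric v v -
  minkowski_metric (tangent_part psi x y v) (tangent_part psi x y v).
Proof.
have [/[swap] Nv /Nv Ov] := tangent_partP v Spsi Ix Jy.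
set t := tangent_part psi x y v in Ov *; set n := normal_part psi x y v in Ov *.
have -> : v = n + t by rewrite /n /normal_part subrK.
move: t n Ov => t n Ov.
by rewrite !(metricDl, metricDr) (metricC t n) Ov addr0 add0r addrK.
Qed.

Lemma normal_part_neq0 : ~ tangent_plane psi x y v -> normal_part psi x y v <> 0.
Proof.
have [Tv _] := tangent_partP v Spsi Ix Jy.
by move=> nTv /subr0_eq vE; apply: nTv; rewrite vE.
Qed.

(** When the coordinate directions are orthogonal, the coefficients of the
    tangent part decouple; the one along psi_y is proportional to <v, psi_y>. *)
Lemma tangent_part_orthogonal :
  minkowski_metric (partial_x psi x y) (partial_y psi x y) = 0 ->
  minkowski_metric v (partial_y psi x y) = 0 ->
  tangent_part psi x y v =
  (minkowski_metric v (partial_x psi x y) /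
   minkowski_metric (partial_x psi x y) (partial_x psi x y))
  *: partial_x psi x y.
Proof.
have E0 : minkowski_metric (partial_x psi x y) (partial_x psi x y) != 0.
  have /= := Spsi x y Ix Jy 1 0.
  rewrite scale1r scale0r addr0 => /(_ _)/lt0r_neq0; apply.
  by case=> /eqP; rewrite oner_eq0.
move=> pq vq; apply: tangent_part_unique Spsi Ix Jy _ _.
  by eexists; exists 0; rewrite scale0r addr0.
move=> _ [a [b ->]].
rewrite !(metricDl, metricDr, metricNl, metricZl, metricZr) pq vq.
by rewrite !mulr0 !addr0 (mulrC a (minkowski_metric (partial_x psi x y) _)) mulrA
  divfK// mulrC subrr.
Qed.

End NormalPart.
Arguments metric_normal_part {R I J psi x y}.
Arguments normal_part_neq0 {R I J psi x y}.
Arguments tangent_part_orthogonal {R I J psi x y}.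

Theorem proposition3p1 (R : realType) (I J : set R)
    (alpha delta : R -> 'rV[R]_4)
    (hI : open_interval I) (hJ : open_interval J)
    (alpha_smooth : smooth_on I alpha) (delta_smooth : smooth_on J delta)
    (alpha_regular : regular_on I alpha) (delta_regular : regular_on J delta)
    (alpha_spacelike : spacelike_curve I alpha)
    (delta_spacelike : spacelike_curve J delta)
    (orthogonal : forall x y, I x -> J y ->
       minkowski_metric (derive1 alpha x) (derive1 delta y) = 0)
    (delta_hyperplane : forall y, J y -> minkowski_metric (delta y) e1 = 0)
    (M_spacelike : spacelike_surface I J (translation_surface alpha delta))
    (e1_transverse : nowhere_tangent I J (translation_surface alpha delta) e1) :
  canonical_normal_null_direction I J (translation_surface alpha delta) e1 <->
  (forall x y, I x -> J y ->
     minkowski_metric (tangent_part (translation_surface alpha delta) x y e1)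
       (derive1 alpha x) ^+ 2
     = minkowski_metric (derive1 alpha x) (derive1 alpha x)).
Proof.
have psix x y : partial_x (translation_surface alpha delta) x y = derive1 alpha x.
  exact: derive1_add_cst.
have psiy x y : partial_y (translation_surface alpha delta) x y = derive1 delta y.
  exact: derive1_cst_add.
have e1_delta' y : J y -> minkowski_metric e1 (derive1 delta y) = 0.
  move=> Jy; rewrite metricC metric_e1r.
  apply: (@derive1_coord_cst _ _ _ _ J y 0) => //; first by case: hJ.
    exact: (delta_smooth 0%N).
  by move=> t /delta_hyperplane; rewrite metric_e1r.
suff pointwise x y : I x -> J y ->
    lightlike (normal_part (translation_surface alpha delta) x y e1) <->
    minkowski_metric (tangent_part (translation_surface alpha delta) x y e1)
      (derive1 alpha x) ^+ 2
    = minkowski_metric (derive1 alpha x) (derive1 alpha x).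
  by split=> H x y Ix Jy; apply/pointwise => //; exact: H.
move=> Ix Jy; have E0 := lt0r_neq0 (alpha_spacelike x Ix).
rewrite /lightlike (metric_normal_part M_spacelike Ix Jy).
rewrite (tangent_part_orthogonal M_spacelike Ix Jy) ?psix ?psiy; do ?by auto.
rewrite metric_e1r !(metricZl, metricZr) mxE !eqxx divfK//.
set c := minkowski_metric e1 _; set E := minkowski_metric _ _ in E0 *.
have -> : c / E * c = c ^+ 2 / E by rewrite mulrAC -expr2.
split=> [[_ /subr0_eq/esym/divr1_eq//]|->].
split; last by rewrite divff// subrr.
exact: normal_part_neq0 M_spacelike Ix Jy _ (e1_transverse x y Ix Jy).
Qed.
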